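(* Let $N$ be an even positive integer, let $X(0),X(1),\dots,X(N/2-1)$ be real numbers, and let $$J(\tau)=2\sum_{u=0}^{N/2-1}X(u)\Bigl(1+\cos\bigl(\tfrac{2\pi}{N}\tau u\bigr)\Bigr),\qquad \tau=-N/2,\dots,N/2-1.$$ Then $X$ can be calculated from $J$ as follows: $$X(u)=\begin{cases}\dfrac1N\displaystyle\sum_{\tau=-N/2}^{N/2-1}J(\tau)\cos\bigl(\tfrac{2\pi}{N}\tau u\bigr), & u=1,\dots,N/2-1,\\[2mm] \dfrac1{4N}\displaystyle\sum_{\tau=-N/2}^{N/2-1}J(\tau)-\dfrac12\sum_{u_1=1}^{N/2-1}X(u_1), & u=0.\end{cases}$$ Moreover, let $x(u)$, $u=1,\dots,N$, be defined in either of the following two ways: (1) $x(u)=\operatorname{Re}\bigl(\mathrm{IFFT}(J)(u)\cdot\exp(-j\pi(u-1))\bigr)$; (2) $x(u)=\operatorname{Re}\bigl(\mathrm{IFFT}(\mathrm{fftshift}(J))(u)\bigr)$; where $J$ denotes the sequence $(J(-N/2),J(-N/2+1),\dots,J(N/2-1))$. Then, in each of the two cases, $$X(u)=\begin{cases}x(u+1), & u=1,2,\dots,N/2-1,\\[1mm] \dfrac1{4N}\displaystyle\sum_{\tau=-N/2}^{N/2-1}J(\tau)-\dfrac12\sum_{u_1=1}^{N/2-1}X(u_1), & u=0.\end{cases}$$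
   Context: Here $j$ is the imaginary unit. For a sequence $y=(y_1,\dots,y_N)$ of complex numbers, the inverse FFT (MATLAB convention) is the sequence indexed by $u=1,\dots,N$ given by $$\mathrm{IFFT}(y)(u)=\frac1N\sum_{k=1}^{N}y_k\exp\bigl(j\tfrac{2\pi}{N}(k-1)(u-1)\bigr).$$ Applied to the sequence $(J(-N/2),\dots,J(N/2-1))$, this means $y_k=J(k-1-N/2)$, $k=1,\dots,N$. The operation $\mathrm{fftshift}$ circularly shifts this sequence so that the entry $\tau=0$ comes first: $\mathrm{fftshift}(J)=(J(0),J(1),\dots,J(N/2-1),J(-N/2),J(-N/2+1),\dots,J(-1))$. *)

(* Defs.v *)
From mathcomp Require Import all_boot all_order all_algebra.
From mathcomp Require Import complex.
From mathcomp Require Import reals sequences exp trigo.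

Set Implicit Arguments.
Unset Strict Implicit.
Unset Printing Implicit Defensive.

Import Order.TTheory GRing.Theory Num.Theory.
Local Open Scope ring_scope.
Local Open Scope complex_scope.

(* exp (a + jb) = e^a (cos b + j sin b) *)
Definition cexp (R : realType) (z : R[i]) : R[i] :=
  (expR (complex.Re z))%:C * (cos (complex.Im z) +i* sin (complex.Im z)).

(* Inverse FFT, MATLAB convention: a sequence y_1, ..., y_N is stored as
   y : seq R[i] with N = size y, so that the entry y_k is y`_(k - 1).
   The output is also indexed from u = 1; arguments outside 1 <= u <= N are
   not meaningful. *)
Definition IFFT (R : realType) (y : seq R[i]) (u : nat) : R[i] :=
  let N := size y in
  N%:R^-1 *
  \sum_(1 <= k < N.+1)
     y`_(k - 1) * cexp ('i%C * (2 * pi / N%:R * (k - 1)%:R * (u - 1)%:R)%:C).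

(* Circular shift bringing the entry at (0-based) position (size s)./2 to the
   front. For even size it exchanges the two halves of s. *)
Definition fftshift (T : Type) (s : seq T) : seq T := rot (size s)./2 s.

(* For even N, the integers -N/2, -N/2 + 1, ..., N/2 - 1 in this order. *)
Definition centered_range (N : nat) : seq int :=
  [seq k%:Z - (N./2)%:Z | k <- iota 0 N].

(* The sequence (J(-N/2), ..., J(N/2 - 1)), viewed as complex numbers. *)
Definition centered_seq (R : realType) (N : nat) (J : int -> R) : seq R[i] :=
  [seq (J tau)%:C | tau <- centered_range N].

(* Main.v *)
Require Import Defs.
From mathcomp Require Import all_boot all_order all_algebra.
From mathcomp Require Import complex.
From mathcomp Require Import reals sequences exp trigo.
From mathcomp Require Import ring zify.

Import Order.TTheory GRing.Theory Num.Theory.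
Local Open Scope ring_scope.
Local Open Scope complex_scope.

(** Up to the constant terms, J is the cosine transform of X over the centred
    period -N/2, ..., N/2 - 1, so inverting it is a matter of discrete
    orthogonality. A cosine of nonzero frequency m < N sums to zero over N
    equally spaced points ([sum_cos_arith]); by the product-to-sum formula,
    cosines of frequencies u and v with u + v < N are therefore orthogonal,
    with square norm N/2 when u = v > 0 ([sum_cosM_centered]). The bounds
    0 < u < N/2 and v < N/2 guarantee u + v < N, so that no aliasing occurs.
    Correlating J with the cosine of frequency u > 0 kills the constant term
    of each 1 + cos and leaves N X(u) ([sum_cos_spectrum]). Correlating with
    the constant 1 gives 4N X(0) + 2N (X(1) + ... + X(N/2 - 1)), because the
    cosine of frequency 0 adds up with the constant term; this is solved for
    X(0) ([sum_spectrum]).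

    The two IFFT procedures compute the same correlation. The IFFT indexes the
    samples by k = tau + N/2. Multiplying by exp (- j pi (u - 1)) subtracts
    the phase (2 pi / N) (N/2) (u - 1) caused by this offset
    ([Re_IFFT_demodulated]); exchanging the two halves instead puts each sample
    at an index congruent to tau modulo N, where the exponential takes the same
    value ([Re_IFFT_fftshift]). *)

(** * Orthogonality of cosines over a period *)

Lemma natr_even (R : pzRingType) (N : nat) :
  ~~ odd N -> N%:R = 2 * (N./2)%:R :> R.
Proof. by move=> Ne; rewrite -natrM mul2n even_halfK. Qed.

Lemma cosD_nat2pi (R : realType) (a : R) (n : nat) :
  cos (a + 2 * pi * n%:R) = cos a.
Proof.
have -> : 2 * pi * n%:R = pi *+ 2 *+ n :> R by rewrite mulr_natr mulr_natl.
exact: (periodicn (@cosD2pi R)).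
Qed.

(** Multiplying by sin (h / 2), where h is the common difference of the angles,
    turns each term into a difference of consecutive sines. The sum telescopes
    to the difference of sines at angles that are N h = 2 pi m apart. The
    bounds on m put h / 2 strictly between 0 and pi, so that the multiplier is
    nonzero. *)
Lemma sum_cos_arith (R : realType) (N m : nat) (a : R) : (0 < m < N)%N ->
  \sum_(0 <= k < N) cos (2 * pi / N%:R * m%:R * k%:R + a) = 0.
Proof.
case/andP=> m_gt0 mN.
have N_gt0 : 0 < N%:R :> R by rewrite ltr0n; lia.
have N_neq0 : N%:R != 0 :> R by rewrite gt_eqF.
set h : R := 2 * pi / N%:R * m%:R.
have sin_neq0 : sin (h / 2) != 0.
  rewrite gt_eqF// sin_gt0_pi//.
  have -> : h / 2 = pi * (m%:R / N%:R) by rewrite /h; field.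
  rewrite pmulr_rgt0 ?pi_gt0// divr_gt0 ?ltr0n //=; last lia.
  by rewrite gtr_pMr ?pi_gt0// ltr_pdivrMr// mul1r ltr_nat mN.
apply: (mulfI sin_neq0); rewrite mulr0.
pose f k := sin (h * k%:R + a - h / 2) / 2.
rewrite mulr_sumr (eq_bigr (fun k => f k.+1 - f k)); last first.
  move=> k _; rewrite /f -(natr1 k).
  have -> : h * (k%:R + 1) + a - h / 2 = (h * k%:R + a) + h / 2 by field.
  by rewrite sinB sinD; field.
rewrite telescope_sumr// /f.
have -> : h * N%:R + a - h / 2 = h * 0%:R + a - h / 2 + pi *+ 2 *+ m.
  by rewrite /h -mulr_natr -[pi *+ 2]mulr_natl; field.
by rewrite (periodicn (@sinD2pi R)) subrr.
Qed.

Lemma big_centered_range (V : nmodType) (N : nat) (F : int -> V) :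
  \sum_(tau <- centered_range N) F tau =
  \sum_(0 <= k < N) F (k%:Z - (N./2)%:Z).
Proof. by rewrite /centered_range big_map /index_iota subn0. Qed.

Lemma mem_centered_range (N : nat) (tau : int) : ~~ odd N ->
  tau \in centered_range N -> - (N./2)%:Z <= tau <= (N./2)%:Z - 1.
Proof.
move=> Ne /mapP[k]; rewrite mem_iota => /andP[_ kN] ->.
have := even_halfK Ne; lia.
Qed.

Lemma sum_cos_centered (R : realType) (N m : nat) : (0 < m < N)%N ->
  \sum_(tau <- centered_range N) cos (2 * pi / N%:R * tau%:~R * m%:R) = 0 :> R.
Proof.
move=> mN; rewrite big_centered_range.
rewrite -[RHS](@sum_cos_arith R N m (- (2 * pi / N%:R * m%:R * (N./2)%:R)) mN).
by apply: eq_bigr => k _; congr cos; rewrite rmorphB /=; ring.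
Qed.

(** The product of the two cosines is the mean of the cosines of frequencies
    u + v and |u - v|. Both frequencies are below N, and the first is positive,
    so only |u - v| = 0 can give a nonzero sum. *)
Lemma sum_cosM_centered (R : realType) (N u v : nat) :
  (0 < u)%N -> (u + v < N)%N ->
  \sum_(tau <- centered_range N)
     cos (2 * pi / N%:R * tau%:~R * u%:R) * cos (2 * pi / N%:R * tau%:~R * v%:R)
  = (if u == v then N%:R / 2 else 0) :> R.
Proof.
move=> u_gt0 uvN.
pose C m : R := \sum_(tau <- centered_range N)
  cos (2 * pi / N%:R * tau%:~R * m%:R).
have C0 : C 0%N = N%:R.
  rewrite /C big_centered_range.
  under eq_bigr do rewrite mulr0 cos0.
  by rewrite big_const_nat subn0 iter_addr_0.
have Cuv : C (u + v)%N = 0 by apply: sum_cos_centered; lia.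
(* With truncated subtraction, (u - v) + (v - u) is the distance |u - v|. *)
transitivity ((C (u + v)%N + C ((u - v) + (v - u))%N) / 2).
  rewrite /C -big_split /= mulr_suml; apply: eq_bigr => tau _.
  set w := 2 * pi / N%:R * tau%:~R.
  have -> : cos (w * ((u - v) + (v - u))%:R) = cos (w * u%:R - w * v%:R).
    case/orP: (leq_total u v) => uv.
      have /eqP -> : (u - v == 0)%N by rewrite subn_eq0.
      by rewrite add0n natrB// -cosN; congr cos; ring.
    have /eqP -> : (v - u == 0)%N by rewrite subn_eq0.
    by rewrite addn0 natrB// mulrBr.
  by rewrite natrD mulrDr cosD cosB; field.
rewrite Cuv add0r; case: eqP => [<-|/eqP uv]; first by rewrite subnn addn0 C0.
by rewrite [C _]sum_cos_centered ?mul0r//; lia.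
Qed.

(** * Correlating the transform with a cosine *)

Lemma sum_cos_spectrum (R : realType) (N u : nat) (X : nat -> R) :
  (0 < u < N./2)%N ->
  \sum_(tau <- centered_range N)
     (2 * \sum_(0 <= v < N./2) X v * (1 + cos (2 * pi / N%:R * tau%:~R * v%:R)))
     * cos (2 * pi / N%:R * tau%:~R * u%:R) = N%:R * X u.
Proof.
case/andP=> u_gt0 uN.
have N2 : (N./2 + N./2 <= N)%N by rewrite addnn -[leqRHS]odd_double_half leq_addl.
under eq_bigr => tau _ do rewrite mulrAC mulr_sumr.
rewrite exchange_big /=.
transitivity (\sum_(0 <= v < N./2) (if u == v then N%:R * X v else 0)).
  apply: eq_big_nat => v /andP[_ vN].
  transitivity (2 * X v *
    (\sum_(tau <- centered_range N) cos (2 * pi / N%:R * tau%:~R * u%:R) +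
     \sum_(tau <- centered_range N)
       cos (2 * pi / N%:R * tau%:~R * u%:R) *
       cos (2 * pi / N%:R * tau%:~R * v%:R))).
    rewrite -big_split mulr_sumr; apply: eq_bigr => tau _ /=; ring.
  rewrite sum_cos_centered ?sum_cosM_centered; try lia.
  by case: eqP => _; field.
rewrite -big_mkcond big_nat_cond (eq_bigl (fun v => (0 <= v < N./2) && (v == u))%N).
  by rewrite -big_nat_cond big_nat1_eq /= uN.
by move=> v; rewrite eq_sym.
Qed.

Lemma sum_spectrum (R : realType) (N : nat) (X : nat -> R) :
  (0 < N)%N -> ~~ odd N ->
  \sum_(tau <- centered_range N)
     2 * (\sum_(0 <= v < N./2) X v * (1 + cos (2 * pi / N%:R * tau%:~R * v%:R)))
  = 4 * N%:R * X 0%N + 2 * N%:R * \sum_(1 <= v < N./2) X v.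
Proof.
move=> N_gt0 Ne.
have N2 : (0 < N./2)%N by have := even_halfK Ne; lia.
have sum1 (c : R) : \sum_(tau <- centered_range N) c = N%:R * c.
  by rewrite big_centered_range big_const_nat subn0 iter_addr_0 mulr_natl.
under eq_bigr do rewrite mulr_sumr.
rewrite exchange_big /= big_ltn//; congr (_ + _).
  under eq_bigr do rewrite mulr0 cos0.
  by rewrite sum1; ring.
rewrite mulr_sumr; apply: eq_big_nat => v /andP[v_gt0 vN].
rewrite -mulr_sumr -mulr_sumr big_split /= sum1 sum_cos_centered; last first.
  by have := even_halfK Ne; lia.
ring.
Qed.

(** * The two inverse FFT procedures *)

Lemma cexp_imag (R : realType) (t : R) :
  cexp ('i%C * t%:C) = cos t +i* sin t.
Proof.
rewrite /cexp; simpc.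
by rewrite /= expR0 !mul1r.
Qed.

Lemma Re_sum (R : realType) (I : Type) (s : seq I) (F : I -> R[i]) :
  complex.Re (\sum_(i <- s) F i) = \sum_(i <- s) complex.Re (F i).
Proof. by apply: (big_morph _ _ _) => // [[a b] [c d]]. Qed.

Lemma Re_realM (R : realType) (c : R) (z : R[i]) :
  complex.Re (c%:C * z) = c * complex.Re z.
Proof. by case: z => a b; simpc. Qed.

(** The free phase b lets one formula serve both procedures: b = - pi (u - 1)
    for the demodulated transform, b = 0 for the shifted one. *)
Lemma Re_IFFT_phase (R : realType) (y : seq R) (u : nat) (b : R) :
  complex.Re (IFFT [seq t%:C | t <- y] u * cexp ('i%C * b%:C)) =
  (size y)%:R^-1 *
  \sum_(0 <= k < size y)
     y`_k * cos (2 * pi / (size y)%:R * k%:R * (u - 1)%:R + b).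
Proof.
rewrite /IFFT size_map -[X in complex.Re X]mulrA.
have -> : (size y)%:R^-1 = ((size y)%:R^-1)%:C :> R[i].
  by rewrite fmorphV rmorph_nat.
rewrite Re_realM mulr_suml Re_sum big_add1 /=; congr (_ * _).
apply: eq_big_nat => k /andP[_ ky].
rewrite subn1 /= (nth_map 0)// -mulrA Re_realM !cexp_imag.
by rewrite cosD.
Qed.

Lemma size_centered_range (N : nat) : size (centered_range N) = N.
Proof. by rewrite size_map size_iota. Qed.

Lemma nth_centered (R : realType) (N k : nat) (J : int -> R) : (k < N)%N ->
  [seq J tau | tau <- centered_range N]`_k = J (k%:Z - (N./2)%:Z).
Proof.
move=> kN; rewrite (nth_map 0) ?size_centered_range//.
by rewrite (nth_map 0%N) ?size_iota// nth_iota.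
Qed.

Lemma centered_seqE (R : realType) (N : nat) (J : int -> R) :
  centered_seq N J = [seq t%:C | t <- [seq J tau | tau <- centered_range N]].
Proof. by rewrite -map_comp. Qed.

(** The phase pi (u - 1) is the one that the index offset N/2 contributes:
    (2 pi / N) k (u - 1) - pi (u - 1) = (2 pi / N) (k - N/2) (u - 1). *)
Lemma Re_IFFT_demodulated (R : realType) (N u : nat) (J : int -> R) :
  (0 < N)%N -> ~~ odd N ->
  complex.Re (IFFT (centered_seq N J) u * cexp (- 'i%C * (pi * (u - 1)%:R)%:C))
  = N%:R^-1 * \sum_(tau <- centered_range N)
                 J tau * cos (2 * pi / N%:R * tau%:~R * (u - 1)%:R).
Proof.
move=> N_gt0 Ne.
have := natr_even R _ Ne; set M := (N./2)%:R => NE.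
have M0 : M != 0 by rewrite pnatr_eq0; have := even_halfK Ne; lia.
have -> : - 'i%C * (pi * (u - 1)%:R)%:C = 'i%C * (- (pi * (u - 1)%:R))%:C :> R[i].
  by rewrite rmorphN mulNr mulrN.
rewrite centered_seqE Re_IFFT_phase size_map size_centered_range.
rewrite big_centered_range; congr (_ * _); apply: eq_big_nat => k /andP[_ kN].
rewrite nth_centered//; congr (_ * cos _).
by rewrite rmorphB /= NE /M; field.
Qed.

(** The sample at tau >= 0 moves to index tau, where its angle is the wanted one.
    The sample at tau < 0 moves to index tau + N, where its angle is too large
    by 2 pi (u - 1), a multiple of the period. *)
Lemma Re_IFFT_fftshift (R : realType) (N u : nat) (J : int -> R) :
  (0 < N)%N -> ~~ odd N ->
  complex.Re (IFFT (fftshift (centered_seq N J)) u)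
  = N%:R^-1 * \sum_(tau <- centered_range N)
                 J tau * cos (2 * pi / N%:R * tau%:~R * (u - 1)%:R).
Proof.
move=> N_gt0 Ne.
have NM := even_halfK Ne; rewrite -addnn in NM.
have MN : (N./2 <= N)%N by lia.
have N0 : N%:R != 0 :> R by rewrite pnatr_eq0; lia.
pose y := [seq J tau | tau <- centered_range N].
have sy : size y = N by rewrite size_map size_centered_range.
have -> : fftshift (centered_seq N J) = [seq t%:C | t <- rot N./2 y].
  by rewrite /fftshift centered_seqE map_rot size_map sy.
have /= := Re_IFFT_phase R (rot N./2 y) u 0.
rewrite cexp_imag cos0 sin0 (_ : 1 +i* 0 = 1) // mulr1 => ->.
rewrite size_rot sy big_centered_range; congr (_ * _).
under eq_bigr do rewrite addr0.
have upper_half (F : nat -> R) :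
    \sum_(N./2 <= k < N) F k = \sum_(0 <= k < N./2) F (k + N./2)%N.
  by rewrite -{1}[N./2]add0n big_addn (_ : N - N./2 = N./2)%N //; lia.
pose G k := J (k%:Z - (N./2)%:Z) *
  cos (2 * pi / N%:R * (k%:Z - (N./2)%:Z)%:~R * (u - 1)%:R).
rewrite -/(\sum_(0 <= k < N) G k).
rewrite (big_cat_nat _ MN) //= [RHS](big_cat_nat _ MN) //= addrC.
congr (_ + _).
(* Negative tau: the second half of the shifted sequence. *)
- rewrite upper_half.
  apply: eq_big_nat => k /andP[_ kM].
  rewrite /rot nth_cat size_drop sy ifF; last by apply/negbTE; lia.
  rewrite nth_take; last lia.
  rewrite (_ : _ - _ = k)%N; last lia.
  rewrite nth_centered; last lia.
  rewrite /G; congr (_ * _).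
  rewrite -[RHS](cosD_nat2pi _ _ (u - 1)); congr cos.
  by rewrite rmorphB /= (natr_even R _ Ne) natrD; field; rewrite pnatr_eq0; lia.
(* Nonnegative tau: the first half of the shifted sequence. *)
rewrite upper_half.
apply: eq_big_nat => k /andP[_ kM].
rewrite /rot nth_cat size_drop sy ifT; last lia.
rewrite nth_drop nth_centered; last lia.
by rewrite /G addnC; congr (J _ * cos (_ * _ * _)); rewrite ?rmorphB /= ?natrD; lia || ring.
Qed.

Theorem proposition4 (R : realType) (N : nat) (X : nat -> R) (J : int -> R)
    (N_gt0 : (0 < N)%N) (N_even : ~~ odd N)
    (JE : forall tau : int, - (N./2)%:Z <= tau <= (N./2)%:Z - 1 ->
      J tau = 2 * \sum_(0 <= u < N./2)
                    X u * (1 + cos (2 * pi / N%:R * tau%:~R * u%:R))) :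
  ((forall u : nat, (1 <= u <= N./2 - 1)%N ->
      X u = N%:R^-1 * \sum_(tau <- centered_range N)
                         J tau * cos (2 * pi / N%:R * tau%:~R * u%:R)) /\
   X 0%N = (4 * N%:R)^-1 * (\sum_(tau <- centered_range N) J tau)
           - 2^-1 * \sum_(1 <= u1 < N./2) X u1)
  /\
  (forall x : nat -> R,
     (forall u : nat, (1 <= u <= N)%N ->
        x u = complex.Re (IFFT (centered_seq N J) u *
                          cexp (- 'i%C * (pi * (u - 1)%:R)%:C)))
     \/
     (forall u : nat, (1 <= u <= N)%N ->
        x u = complex.Re (IFFT (fftshift (centered_seq N J)) u)) ->
     (forall u : nat, (1 <= u <= N./2 - 1)%N -> X u = x (u + 1)%N) /\
     X 0%N = (4 * N%:R)^-1 * (\sum_(tau <- centered_range N) J tau)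
             - 2^-1 * \sum_(1 <= u1 < N./2) X u1).
Proof.
have [X0E XE] : X 0%N = (4 * N%:R)^-1 * (\sum_(tau <- centered_range N) J tau)
             - 2^-1 * \sum_(1 <= u1 < N./2) X u1 /\
  (forall u : nat, (1 <= u <= N./2 - 1)%N ->
      X u = N%:R^-1 * \sum_(tau <- centered_range N)
                         J tau * cos (2 * pi / N%:R * tau%:~R * u%:R)).
  have N0 : N%:R != 0 :> R by rewrite pnatr_eq0; lia.
  split=> [|u uM].
    under eq_big_seq do rewrite JE ?mem_centered_range//.
    by rewrite sum_spectrum//; field.
  under eq_big_seq do rewrite JE ?mem_centered_range//.
  by rewrite sum_cos_spectrum ?mulKf//; lia.
split=> // x xE; split=> // u uM; rewrite (XE _ uM).
have uN : (1 <= u + 1 <= N)%N by lia.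
by case: xE => ->//; rewrite ?Re_IFFT_demodulated ?Re_IFFT_fftshift// addnK.
Qed.
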